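(* In a semi-abelian category $\mathcal{X}$, let $F$ be an $n$-cubic central extension ($n\geq 1$) with direction $A$. Then, for any $I\subseteq n$, in the product diagram $$0\longrightarrow A\ \overset{\ker\pi^{I}}{\underset{\mathrm{pr}_A}{\rightleftarrows}}\ \square(F)\ \overset{\pi^{I}}{\underset{\iota^{I}}{\rightleftarrows}}\ \boxdot^{I}(F)\longrightarrow 0$$ (in which $\ker\pi^I$ and $\pi^I$ point to the right, $\mathrm{pr}_A$ and $\iota^I$ point to the left, and $\square(F)$ is the product of $A$ and $\boxdot^I(F)$ with projections $\mathrm{pr}_A$ and $\pi^I$), the projection $\mathrm{pr}_{A}$ is an alternating sum $$\sum_{J\subseteq n}(-1)^{|J|}\,\eta_{F_{n}}\circ \mathrm{pr}_{J},$$ where $\mathrm{pr}_{J}\colon\square(F)\to F_{n}$ sends a diamond to its $J$-face. (That is, the lifting of this sum over $A$ is $\mathrm{pr}_A$.)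
   Context: A semi-abelian category is a pointed, Barr-exact, Bourn-protomodular category with binary coproducts. $\mathrm{Ab}(\mathcal{X})$ is the full reflective subcategory of abelian objects (those admitting an internal abelian group structure), with reflector $\mathrm{ab}$ and unit $\eta$. Morphisms into an abelian object such as $\mathrm{ab}(F_n)$ can be added and subtracted. Higher cubic extensions. Write $n=\{0,\dots,n-1\}$ and let $2^n$ be the poset of subsets of $n$. An $n$-fold arrow is a functor $F\colon (2^n)^{\mathrm{op}}\to\mathcal{X}$, with values $F_I$ and $f_i\colon F_J\to F_{J\setminus\{i\}}$ for $i\in J$; $F_n$ is its initial object and $f_i\colon F_n\to F_{n\setminus\{i\}}$, $i\in n$, are its initial arrows. Splitting according to whether $I$ contains $n-1$, $F$ is a morphism of $(n-1)$-fold arrows; for $n\ge 2$ it is a commutative square $fd=gc$ of $(n-2)$-fold arrows, with $d\colon X\to D$, $c\colon X\to C$, $f\colon D\to Z$, $g\colon C\to Z$. A $0$-cubic extension is an object, a $1$-cubic extension is a regular epimorphism, and for $n\ge2$ an $n$-cubic extension is an $n$-fold arrow which, viewed as such a square, is such that $c,d,f,g$ and $\langle d,c\rangle\colon X\to D\times_Z C$ are $(n-1)$-cubic extensions. $\mathrm{Ext}^n(\mathcal{X})$ is the full subcategory of $n$-cubic extensions. The direction of $F$ is $\bigcap_{i\in n}\mathrm{Ker}(f_i)$, which is abelian when $F$ is central. Centrality (with respect to abelianisation). Put $\mathrm{CExt}^0=\mathrm{Ab}(\mathcal{X})\subseteq\mathrm{Ext}^0(\mathcal{X})=\mathcal{X}$,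 $I_0=\mathrm{ab}$. Inductively, given the reflector $I_k\colon \mathrm{Ext}^k(\mathcal{X})\to\mathrm{CExt}^k$ with unit $\eta^k$, a $(k+1)$-cubic extension, viewed as a morphism $f\colon X\to Y$ in $\mathrm{Ext}^k(\mathcal{X})$, is trivial if the naturality square of $\eta^k$ at $f$ is a pullback, and central if the projections of its kernel pair (equivalently, one of them) are trivial. The central ones form the full subcategory $\mathrm{CExt}^{k+1}\subseteq\mathrm{Ext}^{k+1}(\mathcal{X})$, which is again reflective. Diamonds (described with generalised elements). Let $\mathrm{Eq}(f_i)$ be the kernel pair of $f_i\colon F_n\to F_{n\setminus\{i\}}$. For $J\subseteq n$ let $\square_J(F)\subseteq F_n^{2^J}$ be the object of families $(x_K)_{K\subseteq J}$ with $(x_K,x_{K\cup\{i\}})\in\mathrm{Eq}(f_i)$ for all $K\subseteq J$, $i\in J\setminus K$. Put $\square(F)=\square_n(F)$, the largest $n$-fold equivalence relation on $\mathrm{Eq}(f_0),\dots,\mathrm{Eq}(f_{n-1})$; its elements are called diamonds, and the $J$-face of a diamond is $x_J$. $\boxdot^I(F)$ is the object of diamonds with the $I$-face missing: families $(x_K)_{K\subseteq n,\,K\neq I}$ satisfying the same conditions among the indices $\neq I$. The morphism $\pi^I\colon\square(F)\to\boxdot^I(F)$ forgets $x_I$; its kernel is isomorphic to the direction $A$ of $F$. The canonical sections $e_i\colon\square_{n\setminus\{i\}}(F)\to\square(F)$ send $(x_K)_{K\subseteq n\setminus\{i\}}$ to $(x_{K\setminus\{i\}})_{K\subseteq n}$.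 When $F$ is central, $A$ is abelian, $\pi^I$ is a product projection with kernel $A$, so that $\square(F)\cong A\times\boxdot^I(F)$, and $\iota^I$ is the unique splitting of $\pi^I$ compatible with the canonical sections, i.e. with $\iota^I\circ\pi^I\circ e_i=e_i$ for all $i\in n$.
   Formalization: The direction A is identified with the kernel of π^I by sending a to the diamond with I-face (-1)^{|I|}a and other faces 0; with the unsigned identification the stated sum equals pr_A only up to the sign (-1)^{|I|}. *)

(* Defs.v *)
From HB Require Import structures.
From mathcomp Require Import all_boot ssralg ssrint.
From mathcomp Require Import boolp.

Set Implicit Arguments.
Unset Strict Implicit.
Unset Printing Implicit Defensive.

Import GRing.Theory.

Record category := Category {
  ob :> Type;
  hom : ob -> ob -> Type;
  idm : forall A, hom A A;
  comp : forall A B C, hom B C -> hom A B -> hom A C;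
  comp1m : forall A B (f : hom A B), comp (idm B) f = f;
  compm1 : forall A B (f : hom A B), comp f (idm A) = f;
  compA : forall A B C D (h : hom C D) (g : hom B C) (f : hom A B),
    comp h (comp g f) = comp (comp h g) f
}.

Arguments hom {c} A B.
Arguments idm {c} A.
Arguments comp {c A B C} g f.

Declare Scope cat_scope.
Delimit Scope cat_scope with cat.
Local Open Scope cat_scope.
Notation "g ∘ f" := (comp g f) (at level 40, left associativity) : cat_scope.

Section FullSubcategory.
Variables (C : category) (P : C -> Prop).

Record full_ob := FullOb { full_val : C; full_prop : P full_val }.

Definition full_sub : category :=
  @Category full_ob (fun A B => hom (full_val A) (full_val B))
    (fun A => idm (full_val A)) (fun _ _ _ g f => g ∘ f)
    (fun _ _ f => comp1m f) (fun _ _ f => compm1 f)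
    (fun _ _ _ _ h g f => compA h g f).

End FullSubcategory.

Section CategoryNotions.
Variable C : category.

Definition is_iso (A B : C) (f : hom A B) : Prop :=
  exists g : hom B A, g ∘ f = idm A /\ f ∘ g = idm B.

Definition is_pullback (P A B Z : C) (f : hom A Z) (g : hom B Z)
    (p : hom P A) (q : hom P B) : Prop :=
  f ∘ p = g ∘ q /\
  forall (T : C) (u : hom T A) (v : hom T B), f ∘ u = g ∘ v ->
    exists! w : hom T P, p ∘ w = u /\ q ∘ w = v.

Definition is_product (P A B : C) (p : hom P A) (q : hom P B) : Prop :=
  forall (T : C) (u : hom T A) (v : hom T B),
    exists! w : hom T P, p ∘ w = u /\ q ∘ w = v.

Definition is_coproduct (S A B : C) (i : hom A S) (j : hom B S) : Prop :=
  forall (T : C) (u : hom A T) (v : hom B T),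
    exists! w : hom S T, w ∘ i = u /\ w ∘ j = v.

Definition is_coequalizer (R A B : C) (u v : hom R A) (q : hom A B) : Prop :=
  q ∘ u = q ∘ v /\
  forall (T : C) (t : hom A T), t ∘ u = t ∘ v -> exists! w : hom B T, w ∘ q = t.

Definition regular_epi (A B : C) (f : hom A B) : Prop :=
  exists (R : C) (u v : hom R A), is_coequalizer u v f.

Definition in_relation (R A : C) (r1 r2 : hom R A) (T : C) (x y : hom T A) : Prop :=
  exists w : hom T R, r1 ∘ w = x /\ r2 ∘ w = y.

Definition is_equivalence_relation (R A : C) (r1 r2 : hom R A) : Prop :=
  [/\ forall (T : C) (w w' : hom T R),
        r1 ∘ w = r1 ∘ w' -> r2 ∘ w = r2 ∘ w' -> w = w',
      forall (T : C) (x : hom T A), in_relation r1 r2 x x,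
      forall (T : C) (x y : hom T A),
        in_relation r1 r2 x y -> in_relation r1 r2 y x
    & forall (T : C) (x y z : hom T A),
        in_relation r1 r2 x y -> in_relation r1 r2 y z -> in_relation r1 r2 x z].

Definition has_pullbacks : Prop :=
  forall (A B Z : C) (f : hom A Z) (g : hom B Z),
    exists (P : C) (p : hom P A) (q : hom P B), is_pullback f g p q.

Definition has_binary_coproducts : Prop :=
  forall A B : C, exists (S : C) (i : hom A S) (j : hom B S), is_coproduct i j.

(* The terminal object, the other half of finite completeness, is supplied
   by the zero object of a semi-abelian category below. *)
Definition barr_exact : Prop :=
  [/\ has_pullbacks,
      forall (R A B : C) (f : hom A B) (r1 r2 : hom R A),
        is_pullback f f r1 r2 ->
        exists (Q : C) (q : hom A Q), is_coequalizer r1 r2 q,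
      forall (P A B Z : C) (f : hom A Z) (g : hom B Z) (p : hom P A) (q : hom P B),
        is_pullback f g p q -> regular_epi f -> regular_epi q
    & forall (R A : C) (r1 r2 : hom R A), is_equivalence_relation r1 r2 ->
        exists (B : C) (f : hom A B), is_pullback f f r1 r2].

(* For every v : E -> B, the change-of-base functor from points (split
   epimorphisms with a chosen section) over B to points over E reflects
   isomorphisms. *)
Definition protomodular : Prop :=
  forall (E B : C) (v : hom E B)
    (A A' : C) (p : hom A B) (s : hom B A) (p' : hom A' B) (s' : hom B A')
    (phi : hom A A')
    (P P' : C) (a : hom P A) (b : hom P E) (a' : hom P' A') (b' : hom P' E)
    (psi : hom P P'),
  p ∘ s = idm B -> p' ∘ s' = idm B -> p' ∘ phi = p -> phi ∘ s = s' ->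
  is_pullback p v a b -> is_pullback p' v a' b' ->
  a' ∘ psi = phi ∘ a -> b' ∘ psi = b ->
  is_iso psi -> is_iso phi.

(* eta : A -> B exhibits B as the reflection of A in the full subcategory P. *)
Definition is_reflection (P : C -> Prop) (A B : C) (eta : hom A B) : Prop :=
  P B /\ forall B' : C, P B' -> forall f : hom A B', exists! g : hom B B', g ∘ eta = f.

Definition trivial_mor (P : C -> Prop) (A B : C) (f : hom A B) : Prop :=
  exists (A' B' : C) (etaA : hom A A') (etaB : hom B B') (f' : hom A' B'),
  [/\ is_reflection P etaA, is_reflection P etaB, f' ∘ etaA = etaB ∘ f
    & is_pullback f' etaB etaA f].

Definition central_mor (P : C -> Prop) (A B : C) (f : hom A B) : Prop :=
  exists (R : C) (p q : hom R A),
  [/\ is_pullback f f p q, trivial_mor P p & trivial_mor P q].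

End CategoryNotions.

Record semiabelian := SemiAbelian {
  sa_cat :> category;
  zero_ob : sa_cat;
  to_zero : forall A : sa_cat, hom A zero_ob;
  to_zero_uniq : forall (A : sa_cat) (f : hom A zero_ob), f = to_zero A;
  from_zero : forall A : sa_cat, hom zero_ob A;
  from_zero_uniq : forall (A : sa_cat) (f : hom zero_ob A), f = from_zero A;
  prod_ob : sa_cat -> sa_cat -> sa_cat;
  proj1m : forall A B, hom (prod_ob A B) A;
  proj2m : forall A B, hom (prod_ob A B) B;
  pairm : forall T A B, hom T A -> hom T B -> hom T (prod_ob A B);
  proj1_pairm : forall T A B (u : hom T A) (v : hom T B), proj1m A B ∘ pairm u v = u;
  proj2_pairm : forall T A B (u : hom T A) (v : hom T B), proj2m A B ∘ pairm u v = v;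
  pairm_uniq : forall T A B (w w' : hom T (prod_ob A B)),
    proj1m A B ∘ w = proj1m A B ∘ w' -> proj2m A B ∘ w = proj2m A B ∘ w' -> w = w';
  sa_coproducts : has_binary_coproducts sa_cat;
  sa_exact : barr_exact sa_cat;
  sa_protomodular : protomodular sa_cat
}.

Arguments zero_ob {s}.
Arguments to_zero {s} A.
Arguments from_zero {s} A.
Arguments pairm {s T A B} u v.

Definition zerom (X : semiabelian) (A B : X) : hom A B := from_zero B ∘ to_zero A.
Arguments zerom {X} A B.

(* The axioms are stated on generalised elements. *)
Record abgroup_on (X : semiabelian) (A : X) := AbGroupOn {
  ag_add : hom (prod_ob A A) A;
  ag_zero : hom zero_ob A;
  ag_opp : hom A A;
  ag_addA : forall (T : X) (u v w : hom T A),
    ag_add ∘ pairm u (ag_add ∘ pairm v w) = ag_add ∘ pairm (ag_add ∘ pairm u v) w;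
  ag_addC : forall (T : X) (u v : hom T A), ag_add ∘ pairm u v = ag_add ∘ pairm v u;
  ag_add0 : forall (T : X) (u : hom T A), ag_add ∘ pairm (ag_zero ∘ to_zero T) u = u;
  ag_addN : forall (T : X) (u : hom T A),
    ag_add ∘ pairm (ag_opp ∘ u) u = ag_zero ∘ to_zero T
}.

Definition abelian_ob (X : semiabelian) (A : X) : Prop := inhabited (abgroup_on A).

(* The abelian group of morphisms T -> A, for an internal abelian group G on A. *)
Definition elt (X : semiabelian) (A : X) (G : abgroup_on A) (T : X) : Type := hom T A.

HB.instance Definition _ (X : semiabelian) (A : X) (G : abgroup_on A) (T : X) :=
  gen_eqMixin (elt G T).
HB.instance Definition _ (X : semiabelian) (A : X) (G : abgroup_on A) (T : X) :=
  gen_choiceMixin (elt G T).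
HB.instance Definition _ (X : semiabelian) (A : X) (G : abgroup_on A) (T : X) :=
  GRing.isZmodule.Build (elt G T)
    (@ag_addA X A G T) (@ag_addC X A G T) (@ag_add0 X A G T) (@ag_addN X A G T).

(* Contravariant functors on the poset of subsets of {0, ..., n-1}. *)
Record narrow (X : category) (n : nat) := NArrow {
  nob :> {set 'I_n} -> X;
  nmap : forall I J : {set 'I_n}, I \subset J -> hom (nob J) (nob I);
  nmap_id : forall (I : {set 'I_n}) (h : I \subset I), nmap h = idm (nob I);
  nmap_comp : forall (I J K : {set 'I_n})
    (h : I \subset J) (k : J \subset K) (l : I \subset K), nmap h ∘ nmap k = nmap l
}.

Record nattrans (X : category) (n : nat) (F G : narrow X n) := NatTrans {
  ncomp :> forall I : {set 'I_n}, hom (F I) (G I);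
  ncompP : forall (I J : {set 'I_n}) (h : I \subset J),
    ncomp I ∘ nmap F h = nmap G h ∘ ncomp J
}.

Section NArrowCategory.
Variables (X : category) (n : nat).

Lemma nattrans_eq (F G : narrow X n) (a b : nattrans F G) : (forall I, a I = b I) -> a = b.
Proof.
case: a b => [a Ha] [b Hb] /= eab.
have e : a = b by apply: functional_extensionality_dep.
by case: _ / e in Hb *; congr NatTrans; apply: Prop_irrelevance.
Qed.

Lemma nat_idP (F : narrow X n) (I J : {set 'I_n}) (h : I \subset J) :
  idm (F I) ∘ nmap F h = nmap F h ∘ idm (F J).
Proof. by rewrite comp1m compm1. Qed.
Definition nat_id (F : narrow X n) : nattrans F F := NatTrans (nat_idP F).

Lemma nat_compP (F G H : narrow X n) (b : nattrans G H) (a : nattrans F G)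
    (I J : {set 'I_n}) (h : I \subset J) :
  (b I ∘ a I) ∘ nmap F h = nmap H h ∘ (b J ∘ a J).
Proof. by rewrite -compA ncompP compA ncompP compA. Qed.
Definition nat_comp (F G H : narrow X n) (b : nattrans G H) (a : nattrans F G) :
  nattrans F H := NatTrans (nat_compP b a).

Lemma nat_comp1m (F G : narrow X n) (a : nattrans F G) : nat_comp (nat_id G) a = a.
Proof. by apply: nattrans_eq => I; apply: comp1m. Qed.

Lemma nat_compm1 (F G : narrow X n) (a : nattrans F G) : nat_comp a (nat_id F) = a.
Proof. by apply: nattrans_eq => I; apply: compm1. Qed.

Lemma nat_compA (F G H K : narrow X n)
    (c : nattrans H K) (b : nattrans G H) (a : nattrans F G) :
  nat_comp c (nat_comp b a) = nat_comp (nat_comp c b) a.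
Proof. by apply: nattrans_eq => I; apply: compA. Qed.

Definition Arr : category :=
  Category nat_comp1m nat_compm1 nat_compA.

End NArrowCategory.

Definition widen_set (n : nat) (I : {set 'I_n}) : {set 'I_n.+1} :=
  [set widen_ord (leqnSn n) i | i in I].

Definition widen_set_max (n : nat) (I : {set 'I_n}) : {set 'I_n.+1} :=
  ord_max |: widen_set I.

Lemma widen_setS (n : nat) (I J : {set 'I_n}) :
  I \subset J -> widen_set I \subset widen_set J.
Proof. exact: imsetS. Qed.

Lemma widen_set_maxS (n : nat) (I J : {set 'I_n}) :
  I \subset J -> widen_set_max I \subset widen_set_max J.
Proof. by move=> IJ; apply/setUS/imsetS. Qed.

Lemma widen_set_sub_max (n : nat) (I : {set 'I_n}) : widen_set I \subset widen_set_max I.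
Proof. exact: subsetUr. Qed.

Section Splitting.
Variables (X : category) (n : nat).

Lemma src_id (F : narrow X n.+1) (I : {set 'I_n}) (h : I \subset I) :
  nmap F (widen_set_maxS h) = idm (F (widen_set_max I)).
Proof. exact: nmap_id. Qed.
Lemma src_comp (F : narrow X n.+1) (I J K : {set 'I_n})
    (h : I \subset J) (k : J \subset K) (l : I \subset K) :
  nmap F (widen_set_maxS h) ∘ nmap F (widen_set_maxS k) = nmap F (widen_set_maxS l).
Proof. exact: nmap_comp. Qed.
Definition src (F : narrow X n.+1) : narrow X n := NArrow (src_id F) (src_comp F).

Lemma tgt_id (F : narrow X n.+1) (I : {set 'I_n}) (h : I \subset I) :
  nmap F (widen_setS h) = idm (F (widen_set I)).
Proof. exact: nmap_id. Qed.
Lemma tgt_comp (F : narrow X n.+1) (I J K : {set 'I_n})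
    (h : I \subset J) (k : J \subset K) (l : I \subset K) :
  nmap F (widen_setS h) ∘ nmap F (widen_setS k) = nmap F (widen_setS l).
Proof. exact: nmap_comp. Qed.
Definition tgt (F : narrow X n.+1) : narrow X n := NArrow (tgt_id F) (tgt_comp F).

Lemma splitP (F : narrow X n.+1) (I J : {set 'I_n}) (h : I \subset J) :
  nmap F (widen_set_sub_max I) ∘ nmap (src F) h =
  nmap (tgt F) h ∘ nmap F (widen_set_sub_max J).
Proof.
have l : widen_set I \subset widen_set_max J.
  exact: subset_trans (widen_setS h) (widen_set_sub_max J).
by rewrite /= (nmap_comp F _ _ l) (nmap_comp F _ _ l).
Qed.
Definition split_arrow (F : narrow X n.+1) : @hom (Arr X n) (src F) (tgt F) :=
  @NatTrans X n (src F) (tgt F)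
    (fun I => nmap F (widen_set_sub_max I)) (@splitP F).

Lemma src_morP (F G : narrow X n.+1) (a : nattrans F G)
    (I J : {set 'I_n}) (h : I \subset J) :
  a (widen_set_max I) ∘ nmap (src F) h = nmap (src G) h ∘ a (widen_set_max J).
Proof. exact: (ncompP a (widen_set_maxS h)). Qed.
Definition src_mor (F G : narrow X n.+1) (a : nattrans F G) :
  @hom (Arr X n) (src F) (src G) :=
    @NatTrans X n (src F) (src G) (fun I => a (widen_set_max I)) (@src_morP F G a).

Lemma tgt_morP (F G : narrow X n.+1) (a : nattrans F G)
    (I J : {set 'I_n}) (h : I \subset J) :
  a (widen_set I) ∘ nmap (tgt F) h = nmap (tgt G) h ∘ a (widen_set J).
Proof. exact: (ncompP a (widen_setS h)). Qed.
Definition tgt_mor (F G : narrow X n.+1) (a : nattrans F G) :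
  @hom (Arr X n) (tgt F) (tgt G) :=
    @NatTrans X n (tgt F) (tgt G) (fun I => a (widen_set I)) (@tgt_morP F G a).

End Splitting.

(* [cubic_mor n h]: the morphism h of n-fold arrows, viewed as an (n+1)-fold
   arrow, is an (n+1)-cubic extension.  For n = m+1, h is the square of m-fold
   arrows
       src F --src_mor h--> src G
         |                    |
     split_arrow F       split_arrow G
         v                    v
       tgt F --tgt_mor h--> tgt G                                          *)
Fixpoint cubic_mor (X : category) (n : nat) : forall F G : narrow X n, nattrans F G -> Prop :=
  match n return forall F G : narrow X n, nattrans F G -> Prop with
  | 0 => fun F G h => regular_epi (h set0)
  | m.+1 => fun F G h =>
      [/\ cubic_mor (src_mor h), cubic_mor (split_arrow F),
          cubic_mor (split_arrow G), cubic_mor (tgt_mor h)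
        & exists (P : Arr X m) (p : hom P (src G)) (q : hom P (tgt F))
            (k : @hom (Arr X m) (src F) P),
          [/\ is_pullback (split_arrow G : @hom (Arr X m) _ _) (tgt_mor h) p q,
              p ∘ k = src_mor h, q ∘ k = split_arrow F & cubic_mor k]]
  end.

Definition cubic_extension (X : category) (n : nat) : Arr X n -> Prop :=
  match n return Arr X n -> Prop with
  | 0 => fun _ => True
  | m.+1 => fun F => cubic_mor (split_arrow F)
  end.

Definition Ext (X : category) (n : nat) : category := full_sub (@cubic_extension X n).

Lemma cubic_mor_ends (X : category) (n : nat) (F G : narrow X n) (h : nattrans F G) :
  cubic_mor h -> @cubic_extension X n F /\ @cubic_extension X n G.
Proof. by case: n F G h => [//|n] F G h []. Qed.

Definition ext_src (X : category) (n : nat) (F : Ext X n.+1) : Ext X n :=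
  FullOb (cubic_mor_ends (full_prop F)).1.
Definition ext_tgt (X : category) (n : nat) (F : Ext X n.+1) : Ext X n :=
  FullOb (cubic_mor_ends (full_prop F)).2.
Definition ext_arrow (X : category) (n : nat) (F : Ext X n.+1) :
  hom (ext_src F) (ext_tgt F) := split_arrow (full_val F).

Fixpoint CExt (X : semiabelian) (n : nat) : Ext X n -> Prop :=
  match n return Ext X n -> Prop with
  | 0 => fun F => abelian_ob ((full_val F : narrow X 0) set0)
  | k.+1 => fun F => central_mor (@CExt X k) (ext_arrow F)
  end.

Definition cubic_central_extension (X : semiabelian) (n : nat) (F : narrow X n) : Prop :=
  exists hF : @cubic_extension X n F, CExt (FullOb hF).

Section Diamonds.
Variables (X : semiabelian) (n : nat) (F : narrow X n).

Definition ftop : X := F setT.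
Definition farrow (i : 'I_n) : hom ftop (F (setT :\ i)) := nmap F (subsetDl setT [set i]).

(* The intersection of the kernels of the initial arrows. *)
Record direction := Direction {
  dir_ob :> X;
  dir_incl : hom dir_ob ftop;
  dir_incl0 : forall i, farrow i ∘ dir_incl = zerom _ _;
  dir_lift : forall (T : X) (t : hom T ftop),
    (forall i, farrow i ∘ t = zerom _ _) -> hom T dir_ob;
  dir_liftP : forall (T : X) (t : hom T ftop) (h : forall i, farrow i ∘ t = zerom _ _),
    dir_incl ∘ dir_lift h = t;
  dir_ext : forall (T : X) (u v : hom T dir_ob), dir_incl ∘ u = dir_incl ∘ v -> u = v
}.

(* Families (x_K), K in S, of generalised elements of F_n such that
   (x_K, x_{K u {i}}) is in Eq(f_i) whenever K and K u {i} are in S.  The values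
   of x outside S are irrelevant. *)
Definition compatible (S : {set {set 'I_n}}) (T : X) (x : {set 'I_n} -> hom T ftop) : Prop :=
  forall (K : {set 'I_n}) (i : 'I_n), i \notin K -> K \in S -> i |: K \in S ->
    farrow i ∘ x K = farrow i ∘ x (i |: K).

Record faces_object (S : {set {set 'I_n}}) := FacesObject {
  faces_ob :> X;
  face : {set 'I_n} -> hom faces_ob ftop;
  face_compatible : compatible S face;
  faces_lift : forall (T : X) (x : {set 'I_n} -> hom T ftop), compatible S x -> hom T faces_ob;
  faces_liftP : forall (T : X) (x : {set 'I_n} -> hom T ftop) (hx : compatible S x)
    (K : {set 'I_n}), K \in S -> face K ∘ faces_lift hx = x K;
  faces_ext : forall (T : X) (u v : hom T faces_ob),
    (forall K, K \in S -> face K ∘ u = face K ∘ v) -> u = v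
}.

Definition square (J : {set 'I_n}) := faces_object (powerset J).
Definition diamonds := square setT.
Definition punctured (I : {set 'I_n}) := faces_object [set~ I].

Lemma forget_compatible (I : {set 'I_n}) (D : diamonds) : compatible [set~ I] (face D).
Proof. by move=> K i iK _ _; apply: face_compatible; rewrite // powersetT inE. Qed.
Definition forget (I : {set 'I_n}) (D : diamonds) (E : punctured I) : hom D E :=
  faces_lift E (forget_compatible D).

Lemma degen_compatible (i : 'I_n) (S : square (~: [set i])) :
  compatible (powerset setT) (fun K => face S (K :\ i)).
Proof.
move=> K j jK _ _; have sub (L : {set 'I_n}) : L :\ i \in powerset (~: [set i]).
  by rewrite powersetE setDE subsetIr.
have [eji|nji] := eqVneq j i.
  subst j; rewrite setU1K //.
  have -> // : K :\ i = K by apply/setDidPl; rewrite disjoint_sym disjoints1.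
have e : (j |: K) :\ i = j |: (K :\ i).
  by rewrite setDUl; congr (_ :|: _); apply/setDidPl; rewrite disjoints1 inE.
rewrite e; apply: face_compatible; rewrite ?sub // -?e ?sub //.
by rewrite !inE (negbTE jK) andbF.
Qed.
Definition degen (D : diamonds) (i : 'I_n) (S : square (~: [set i])) : hom S D :=
  faces_lift D (degen_compatible S).

Definition canonical_splitting (I : {set 'I_n}) (D : diamonds) (E : punctured I)
    (S : forall i : 'I_n, square (~: [set i])) (iota : hom E D) : Prop :=
  forget D E ∘ iota = idm _ /\
  forall i : 'I_n, iota ∘ forget D E ∘ degen D (S i) = degen D (S i).

(* The identification of the direction A with the kernel of [forget I D E]:
   an element a of A goes to the diamond with I-face (-1)^|I| a and all other
   faces 0.  The sign is the one that makes the I-th term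
   (-1)^|I| (I-face) of an alternating sum over the faces equal to a. *)
Definition ker_family (A : direction) (G : abgroup_on (dir_ob A)) (I K : {set 'I_n}) :
  hom A ftop :=
  if K == I then dir_incl A ∘ ((idm _ : elt G A) *~ (-1) ^+ #|I|)%R else zerom _ _.

Lemma ker_compatible (A : direction) (G : abgroup_on (dir_ob A)) (I : {set 'I_n}) :
  compatible (powerset setT) (ker_family G I).
Proof.
have z K i : farrow i ∘ ker_family G I K = zerom _ _.
  rewrite /ker_family; case: eqP => _.
    by rewrite compA dir_incl0 /zerom -compA; congr comp; apply: to_zero_uniq.
  by rewrite /zerom compA; congr comp; apply: from_zero_uniq.
by move=> K i _ _ _; rewrite !z.
Qed.
Definition ker_forget (A : direction) (G : abgroup_on (dir_ob A)) (I : {set 'I_n})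
    (D : diamonds) : hom A D :=
  faces_lift D (ker_compatible G I).

End Diamonds.

(* B is the product of A and C, with projections p and q, whose canonical
   injections are k : A -> B (a kernel of q) and s : C -> B. *)
Definition product_diagram (X : semiabelian) (A B C : X)
    (k : hom A B) (p : hom B A) (q : hom B C) (s : hom C B) : Prop :=
  [/\ is_product p q, p ∘ k = idm A, q ∘ k = zerom A C, p ∘ s = zerom C A
    & q ∘ s = idm C].

(* Main.v *)
(* The kernel inclusion [ker_forget] and [iota] are jointly epic, by
   protomodularity, so both sides need only be compared on them.  On the
   kernel only the I-term of the sum survives.  On the punctured object E, let
   rho_i replace every face by its translate in direction i away from I; it
   factors through e_i, and the sum vanishes on e_i by cancellation in pairs.
   The rho_i are commuting idempotents whose kernels have zero intersection,
   because each K <> I differs from I in some direction.  By protomodularity a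
   morphism out of E that kills the images of all the rho_i is zero. *)
Require Import Defs.
From mathcomp Require Import all_boot ssralg ssrint.

Set Implicit Arguments.
Unset Strict Implicit.
Unset Printing Implicit Defensive.

Import GRing.Theory Defs.

Local Open Scope cat_scope.

(** * Kernels, sections and idempotents in a semi-abelian category *)

Section Pointed.
Variable X : semiabelian.
Implicit Types A B C T : X.

Lemma comp_zerom A B C (f : hom B C) : f ∘ zerom A B = zerom A C.
Proof. by rewrite /zerom compA; congr comp; apply: from_zero_uniq. Qed.

Lemma zerom_comp A B C (f : hom A B) : zerom B C ∘ f = zerom A C.
Proof. by rewrite /zerom -compA; congr comp; apply: to_zero_uniq. Qed.

Definition is_kernel K A B (f : hom A B) (k : hom K A) : Prop :=
  f ∘ k = zerom K B /\
  forall T (u : hom T A), f ∘ u = zerom T B -> exists! w : hom T K, k ∘ w = u.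

(** Change of base along 0 -> B sends a point to its kernel; this is the only instance of
    protomodularity used below. *)
Lemma kernel_pullback K A B (f : hom A B) (k : hom K A) :
  is_kernel f k -> is_pullback f (from_zero B) k (to_zero K).
Proof.
case=> fk0 kU; split=> [//|T u v fu].
have [w [wu wU]] := kU T u (etrans fu (congr1 _ (to_zero_uniq v))).
exists w; split=> [|w' [/wU //]].
by split=> //; rewrite (to_zero_uniq v) [LHS]to_zero_uniq.
Qed.

Lemma kernel_exists A B (f : hom A B) :
  exists (K : X) (k : hom K A), is_kernel f k.
Proof.
have [pb _ _ _] := sa_exact X.
have [K [k [z [e kU]]]] := pb _ _ _ f (from_zero B).
exists K, k; split; first by rewrite e (to_zero_uniq z).
move=> T u fu; have [w [[wu _] wU]] := kU T u (to_zero T) fu.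
exists w; split=> // w' w'u; apply: wU; split=> //.
exact: to_zero_uniq.
Qed.

Lemma kernel_mono K A B (f : hom A B) (k : hom K A) T (u v : hom T K) :
  is_kernel f k -> k ∘ u = k ∘ v -> u = v.
Proof.
case=> fk0 kU e; have [|w [_ wU]] := kU T (k ∘ u).
  by rewrite compA fk0 zerom_comp.
by rewrite -(wU u erefl) -(wU v).
Qed.

(** Pull the graphs of [f] and [g] back along each other: their first components force the two
    pullback projections to agree. *)
Lemma equalizer_exists A B (f g : hom A B) :
  exists (M : X) (m : hom M A),
    f ∘ m = g ∘ m /\
    forall T (u : hom T A), f ∘ u = g ∘ u -> exists! w : hom T M, m ∘ w = u.
Proof.
have pairC T S (w : hom T S) C D (u : hom S C) (v : hom S D) :
    pairm u v ∘ w = pairm (u ∘ w) (v ∘ w).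
  by apply: pairm_uniq; rewrite !compA ?proj1_pairm ?proj2_pairm.
have [pb _ _ _] := sa_exact X.
have [M [a [b [e mU]]]] := pb _ _ _ (pairm (idm A) f) (pairm (idm A) g).
have eab : a = b.
  by move: (congr1 (comp (proj1m _ _)) e); rewrite !compA !proj1_pairm !comp1m.
subst b; exists M, a; split.
  by move: (congr1 (comp (proj2m _ _)) e); rewrite !compA !proj2_pairm.
move=> T u fu; have [|w [[wu _] wU]] := mU T u u.
  by rewrite !pairC fu.
by exists w; split=> // w' w'u; apply: wU.
Qed.

(* Protomodularity makes the kernel of [t], a subobject containing [k] and
   [s], an isomorphism. *)
Lemma zero_on_kernel_section A B K C (p : hom A B) (s : hom B A)
    (k : hom K A) (t : hom A C) :
  p ∘ s = idm B -> is_kernel p k ->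
  t ∘ k = zerom K C -> t ∘ s = zerom B C -> t = zerom A C.
Proof.
move=> ps kerk tk ts.
have [M [m kerm]] := kernel_exists t; have [tm mU] := kerm.
have [s' [ms' _]] := mU _ _ ts; have [k' [mk' _]] := mU _ _ tk.
have kerk' : is_kernel (p ∘ m) k'.
  have [pk kU] := kerk; split; first by rewrite -compA mk'.
  move=> T u; rewrite -compA => pmu.
  have [w [wu wU]] := kU _ _ pmu; exists w; split.
    by apply: (kernel_mono kerm); rewrite compA mk'.
  by move=> w' w'u; apply: wU; rewrite -mk' -compA w'u.
have psm : p ∘ m ∘ s' = idm B by rewrite -compA ms'.
have [|||g [_ mg]] := sa_protomodular psm ps erefl ms' (kernel_pullback kerk')
  (kernel_pullback kerk) (psi := idm K).
- by rewrite compm1.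
- exact: compm1.
- by exists (idm K); rewrite comp1m.
by rewrite -[t]compm1 -mg compA tm zerom_comp.
Qed.

(** The idempotent splits as [r = m ∘ p], with [m] the equalizer of [r] and the identity. Then [m]
    is a section of [p], and [p] has the same kernel as [r] because [m] is monic. *)
Lemma zero_on_idempotent A C K (r : hom A A) (k : hom K A) (t : hom A C) :
  r ∘ r = r -> is_kernel r k ->
  t ∘ k = zerom K C -> t ∘ r = zerom A C -> t = zerom A C.
Proof.
move=> rr [rk kU] tk tr.
have [M [m [rm mU]]] := equalizer_exists r (idm A).
rewrite comp1m in rm.
have [p [mp _]] : exists! p, m ∘ p = r by apply: mU; rewrite comp1m.
have mI T (u v : hom T M) : m ∘ u = m ∘ v -> u = v.
  move=> e; have [|w [_ wU]] := mU T (m ∘ u); first by rewrite compA rm comp1m.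
  by rewrite -(wU u erefl) -(wU v).
apply: (@zero_on_kernel_section _ _ _ _ p m k) => //.
- by apply: mI; rewrite compA mp rm compm1.
- split; first by apply: mI; rewrite compA mp rk comp_zerom.
  by move=> T u pu; apply: kU; rewrite -mp -compA pu comp_zerom.
by rewrite -rm compA tr zerom_comp.
Qed.

(** Induction on [s], passing to the kernel of the first idempotent: by commutation the others
    restrict to it, and there those left in [s] still separate. *)
Lemma zero_on_commuting_idempotents (J : eqType) (s : seq J) A C
    (r : J -> hom A A) (t : hom A C) :
  (forall i, r i ∘ r i = r i) ->
  (forall i j, r i ∘ r j = r j ∘ r i) ->
  (forall T (u : hom T A), (forall i, i \in s -> r i ∘ u = zerom T A) ->
    u = zerom T A) ->
  (forall i, i \in s -> t ∘ r i = zerom A C) -> t = zerom A C.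
Proof.
elim: s A r t => [|i s IHs] A r t rr rC sep tr.
  (* With no idempotent left, separation applied to the identity of [A] makes it zero. *)
  by rewrite -[t]compm1 (sep _ (idm A)) ?comp_zerom.
have [K [k kerk]] := kernel_exists (r i); have [rk kU] := kerk.
(* Choice turns the restrictions into a family indexed by [j], as the induction hypothesis
   requires. *)
have restr j : {r' : hom K K | k ∘ r' = r j ∘ k}.
  apply: boolp.cid; have [|w [wu _]] := kU _ (r j ∘ k); last by exists w.
  by rewrite compA rC -compA rk comp_zerom.
apply: (zero_on_idempotent (rr i) kerk); last by apply: tr; rewrite mem_head.
apply: (IHs _ (fun j => sval (restr j))) => [j|j l|T u ru|j js].
- case: (restr j) => r' /= kr'; apply: (kernel_mono kerk).
  by rewrite compA kr' -compA kr' compA rr.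
- case: (restr j) (restr l) => r1 /= kr1 [r2 /= kr2]; apply: (kernel_mono kerk).
  by rewrite !compA kr1 kr2 -!compA kr1 kr2 !compA rC.
- apply: (kernel_mono kerk); rewrite comp_zerom; apply: sep => j.
  rewrite inE => /predU1P[->|/ru]; first by rewrite compA rk zerom_comp.
  by case: (restr j) => r' /= kr' r'u; rewrite compA -kr' -compA r'u comp_zerom.
case: (restr j) => r' /= kr'.
by rewrite -compA kr' compA tr ?zerom_comp // inE js orbT.
Qed.

End Pointed.

(** * Groups of morphisms into an abelian object *)

Section AbelianTarget.
Variables (X : semiabelian) (B : X) (G : abgroup_on B).
Implicit Types T U : X.

Lemma elt0E T : (0 : elt G T)%R = zerom T B.
Proof. by rewrite /zerom -(from_zero_uniq (ag_zero G)). Qed.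

Lemma elt_addC T U (u v : elt G T) (f : hom U T) :
  (u + v : elt G T)%R ∘ f = ((u ∘ f : elt G U) + (v ∘ f : elt G U))%R.
Proof.
rewrite -[LHS]compA; congr comp.
by apply: pairm_uniq; rewrite compA ?proj1_pairm ?proj2_pairm.
Qed.

Lemma elt_oppC T U (u : elt G T) (f : hom U T) :
  (- u : elt G T)%R ∘ f = (- (u ∘ f : elt G U))%R.
Proof. by rewrite -[LHS]compA. Qed.

Lemma elt_signC T U (u : elt G T) (f : hom U T) (n : nat) :
  (u *~ (-1) ^+ n : elt G T)%R ∘ f = ((u ∘ f : elt G U) *~ (-1) ^+ n)%R.
Proof.
by rewrite -signr_odd; case: odd; rewrite ?expr1 ?mulrN1z ?expr0 ?mulr1z ?elt_oppC.
Qed.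

Lemma elt_sumC (J : finType) T U (u : J -> elt G T) (f : hom U T) :
  (\sum_j u j : elt G T)%R ∘ f = (\sum_j (u j ∘ f : elt G U))%R.
Proof.
apply: (big_morph (fun u : elt G T => u ∘ f : elt G U)).
  by move=> v w; apply: elt_addC.
by rewrite !elt0E zerom_comp.
Qed.

(** An abelian target allows subtraction, which reduces equality to the vanishing criterion
    [zero_on_kernel_section]. *)
Lemma elt_ext A C K (p : hom A C) (s : hom C A) (k : hom K A) (u v : elt G A) :
  p ∘ s = idm C -> is_kernel p k -> u ∘ k = v ∘ k -> u ∘ s = v ∘ s -> u = v.
Proof.
move=> ps kerk uk us; apply/eqP; rewrite -subr_eq0; apply/eqP.
rewrite elt0E; apply: (zero_on_kernel_section ps kerk);
  by rewrite elt_addC elt_oppC ?uk ?us subrr elt0E.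
Qed.

End AbelianTarget.

(** * Additivity of morphisms between abelian objects *)

Section AbelianHom.
Variables (X : semiabelian) (A B : X) (GA : abgroup_on A) (G : abgroup_on B).
Variable h : hom A B.

(* On the projections of [A * A], [h] is additive because it is so on the two
   injections, which are jointly epic. *)
Lemma abelian_hom_add T (u v : elt GA T) :
  h ∘ (u + v : elt GA T)%R = ((h ∘ u : elt G T) + (h ∘ v : elt G T))%R.
Proof.
pose p1 : elt GA (prod_ob A A) := proj1m A A.
pose p2 : elt GA (prod_ob A A) := proj2m A A.
pose hp1 : elt G (prod_ob A A) := h ∘ p1; pose hp2 : elt G (prod_ob A A) := h ∘ p2.
have e : h ∘ (p1 + p2 : elt GA _)%R = (hp1 + hp2)%R.
  apply: (@elt_ext _ _ _ _ _ _ (proj2m A A) (pairm (zerom A A) (idm A))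
    (pairm (idm A) (zerom A A))).
  - exact: proj2_pairm.
  - split=> [|U w w2]; first exact: proj2_pairm.
    exists (proj1m A A ∘ w); split=> [|w' <-]; last first.
      by rewrite compA proj1_pairm comp1m.
    by apply: pairm_uniq; rewrite compA ?proj1_pairm ?proj2_pairm ?comp1m
      ?zerom_comp.
  - rewrite -compA !elt_addC /hp1 /hp2 -!compA /p1 /p2 proj1_pairm proj2_pairm.
    by rewrite comp_zerom -(elt0E GA) -(elt0E G) !addr0.
  rewrite -compA !elt_addC /hp1 /hp2 -!compA /p1 /p2 proj1_pairm proj2_pairm.
  by rewrite comp_zerom -(elt0E GA) -(elt0E G) !add0r.
have <- : (p1 + p2)%R ∘ pairm u v = (u + v)%R.
  by rewrite elt_addC proj1_pairm proj2_pairm.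
by rewrite compA e elt_addC /hp1 /hp2 -!compA proj1_pairm proj2_pairm.
Qed.

Lemma abelian_hom_sign T (u : elt GA T) (n : nat) :
  h ∘ (u *~ (-1) ^+ n : elt GA T)%R = ((h ∘ u : elt G T) *~ (-1) ^+ n)%R.
Proof.
rewrite -signr_odd; case: odd; rewrite ?expr1 ?mulrN1z ?expr0 ?mulr1z //.
apply: (@addIr (elt G T) (h ∘ u)).
by rewrite addNr -abelian_hom_add addNr !elt0E comp_zerom.
Qed.

End AbelianHom.

(** * The alternating sum on degenerate diamonds and on the kernel *)

Section Faces.
Variables (X : semiabelian) (n : nat) (F : narrow X n).
Variables (B : X) (G : abgroup_on B) (h : hom (ftop F) B) (D : diamonds F).

(** Only the group structure on the target matters here, so [h] is arbitrary; the theorem takes the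
    unit [eta]. *)
Definition alternating_face_sum : elt G D :=
  (\sum_(J : {set 'I_n}) (h ∘ face D J : elt G D) *~ (-1) ^+ #|J|)%R.

Lemma face_degen (i : 'I_n) (Si : square F (~: [set i])) (K : {set 'I_n}) :
  face D K ∘ degen D Si = face Si (K :\ i).
Proof. by rewrite faces_liftP // powersetT inE. Qed.

Lemma alternating_face_sum_degen (i : 'I_n) (Si : square F (~: [set i])) :
  alternating_face_sum ∘ degen D Si = zerom Si B.
Proof.
rewrite elt_sumC (bigID (fun J : {set 'I_n} => i \in J)) /=.
(* Pair [i |: J] with [J], for [i] outside [J]: a diamond degenerate in direction [i] has equal
   faces there, and the signs are opposite. *)
rewrite (reindex_onto (fun J : {set 'I_n} => i |: J) (fun J => J :\ i)) /=; last first.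
  by move=> J; apply: setD1K.
rewrite (eq_bigl (fun J : {set 'I_n} => i \notin J)) => [|J]; last first.
  rewrite setU11 /=; apply/eqP/idP => [<-|]; last exact: setU1K.
  by rewrite !inE eqxx.
rewrite -big_split big1 ?elt0E //= => J iJ.
rewrite !elt_signC -!compA !face_degen cardsU1 iJ add1n setU1K //.
have -> : J :\ i = J by apply/setDidPl; rewrite disjoint_sym disjoints1.
by rewrite exprS mulN1r mulrNz addNr elt0E.
Qed.

Lemma alternating_face_sum_ker (A : direction F) (GA : abgroup_on (dir_ob A))
    (I : {set 'I_n}) :
  alternating_face_sum ∘ ker_forget GA I D = h ∘ dir_incl A.
Proof.
rewrite elt_sumC (bigD1 I) //= big1 => [|J nJI].
  rewrite addr0 elt_signC -compA faces_liftP ?powersetT ?inE //.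
  rewrite /ker_family eqxx compA (@abelian_hom_sign _ _ _ GA G) compm1.
  (* The sign built into [ker_family] cancels the sign of the [I]-term. *)
  by rewrite -mulrzA -exprMn mulrNN mulr1 expr1n mulr1z.
rewrite elt_signC -compA faces_liftP ?powersetT ?inE //.
by rewrite /ker_family (negbTE nJI) comp_zerom -elt0E mul0rz.
Qed.

End Faces.

(** * Facets of the punctured cube that miss [I] *)

Section Punctured.
Variables (X : semiabelian) (n : nat) (F : narrow X n) (I : {set 'I_n}).

(** Projection of the cube of subsets onto the facet in direction [i] that does not contain the
    vertex [I]. *)
Definition away (i : 'I_n) (K : {set 'I_n}) : {set 'I_n} :=
  if i \in I then K :\ i else i |: K.

Lemma in_away i K j : (j \in away i K) = if j == i then i \notin I else j \in K.
Proof.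
by rewrite /away; case: ifP => iI; rewrite !inE; case: eqP => [->|_].
Qed.

Lemma away_neq i K : away i K \in [set~ I].
Proof.
rewrite !inE; apply/eqP=> /setP/(_ i); rewrite in_away eqxx.
by case: (i \in I).
Qed.

Lemma awayC i j K : away i (away j K) = away j (away i K).
Proof.
apply/setP=> l; rewrite !in_away; case: eqP => [->|//].
by case: eqP => // ->.
Qed.

Lemma away_idem i K : away i (away i K) = away i K.
Proof. by apply/setP=> l; rewrite !in_away; case: eqP. Qed.

Lemma away_setD1 i K : away i (K :\ i) = away i K.
Proof. by apply/setP=> l; rewrite !in_away !inE; case: eqP. Qed.

(** A vertex differing from [I] in coordinate [i] already lies on the facet in direction [i]. *)
Lemma away_fixed K : K != I -> exists i, away i K = K.
Proof.
move=> nKI; have [i iP] : exists i, (i \in K) != (i \in I).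
  apply/existsP; rewrite -negb_forall; apply: contra nKI => /forallP KI.
  by apply/eqP/setP=> i; apply/eqP; have := KI i.
exists i; apply/setP=> l; rewrite in_away; case: eqP => [->|//].
by move: iP; do 2!case: (_ \in _).
Qed.

Variable E : punctured F I.

Lemma away_face_compatible i :
  compatible (powerset (~: [set i])) (fun K => face E (away i K)).
Proof.
move=> K j jK _; rewrite powersetE subsetC sub1set !inE negb_or => /andP[nij _].
have -> : away i (j |: K) = j |: away i K.
  apply/setP=> l; rewrite !(in_away, inE).
  by case: (l =P i) => [->|//]; rewrite (negbTE nij).
have jaK : j \notin away i K by rewrite in_away eq_sym (negbTE nij).
apply: face_compatible (away_neq i K) _ => //.
(* The neighbouring vertex is not the missing one either: since [j] differs from [i], it still
   disagrees with [I] at [i]. *)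
rewrite !inE; apply/eqP=> /setP/(_ i); rewrite in_setU1 (negbTE nij) in_away eqxx.
by case: (i \in I).
Qed.

(** The facet missing [I] has all its vertices in the punctured diamond, so it is a full diamond of
    one dimension less. *)
Definition restrict_away i (Si : square F (~: [set i])) : hom E Si :=
  faces_lift Si (@away_face_compatible i).

Lemma face_degen_restrict (D : diamonds F) i (Si : square F (~: [set i])) K :
  K \in [set~ I] ->
  face E K ∘ (forget D E ∘ degen D Si ∘ restrict_away Si) = face E (away i K).
Proof.
move=> KI; rewrite !compA faces_liftP // face_degen faces_liftP ?away_setD1 //.
by rewrite powersetE setDE subsetIr.
Qed.

Lemma zero_on_degenerate (D : diamonds F) (S : forall i, square F (~: [set i]))
    (B : X) (t : hom E B) :
  (forall i, t ∘ (forget D E ∘ degen D (S i)) = zerom (S i) B) ->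
  t = zerom E B.
Proof.
(* These are the rho_i of the overview; their algebra is that of the maps [away i] on vertices. *)
move=> t0; pose r i := forget D E ∘ degen D (S i) ∘ restrict_away (S i).
have faceE i K : K \in [set~ I] -> face E K ∘ r i = face E (away i K).
  exact: face_degen_restrict.
have faceEE i j K : K \in [set~ I] ->
    face E K ∘ (r i ∘ r j) = face E (away j (away i K)).
  by move=> KI; rewrite compA !faceE ?away_neq.
apply: (@zero_on_commuting_idempotents _ _ (enum 'I_n) _ _ r) => [i|i j|T u ru|i _].
- apply: faces_ext => K KI.
  by rewrite faceEE // faceE // away_idem.
- apply: faces_ext => K KI.
  by rewrite !faceEE // awayC.
(* Separation: for some [i] the [K]-face of [u] is the [K]-face of [r i ∘ u], hence zero. *)
- apply: faces_ext => K KI; have [|i iK] := @away_fixed K; first by rewrite !inE in KI.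
  by rewrite -iK -faceE // -compA ru ?mem_enum // -compA !comp_zerom.
by rewrite compA t0 zerom_comp.
Qed.

End Punctured.

Theorem proposition3p14 (X : semiabelian) (n : nat) (n_ge1 : (1 <= n)%N)
    (F : narrow X n) (F_central : cubic_central_extension F)
    (A : direction F) (GA : abgroup_on (dir_ob A))
    (abFn : X) (eta : hom (ftop F) abFn) (eta_unit : is_reflection (@abelian_ob X) eta)
    (G : abgroup_on abFn)
    (I : {set 'I_n})
    (D : diamonds F) (E : punctured F I) (S : forall i : 'I_n, square F (~: [set i]))
    (iota : hom E D) (iota_canonical : canonical_splitting S iota)
    (prA : hom D A)
    (D_product : product_diagram (ker_forget GA I D) prA (forget D E) iota) :
  (eta ∘ dir_incl A ∘ prA : elt G D)
  = (\sum_(J : {set 'I_n}) (eta ∘ face D J : elt G D) *~ (-1) ^+ #|J|)%R.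
Proof.
have [prod pk qk ps qs] := D_product; have [_ iotaE] := iota_canonical.
have prod_ext T (u v : hom T D) :
    prA ∘ u = prA ∘ v -> forget D E ∘ u = forget D E ∘ v -> u = v.
  move=> e1 e2; have [w [_ wU]] := prod T (prA ∘ u) (forget D E ∘ u).
  by rewrite -(wU u) // -(wU v).
apply: (@elt_ext _ _ G _ _ _ (forget D E) iota (ker_forget GA I D)) => //.
(* In a product, a morphism killed by one projection factors through the kernel injection by its
   other component. *)
- split=> // T u pu; exists (prA ∘ u); split=> [|w <-].
    by apply: prod_ext; rewrite compA ?pk ?comp1m // qk zerom_comp pu.
  by rewrite compA pk comp1m.
- by rewrite alternating_face_sum_ker -compA pk compm1.
(* The left side vanishes on [iota], so the sum must too; canonicity of [iota] reduces this to
   degenerate diamonds. *)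
rewrite -compA ps comp_zerom; symmetry.
apply: (@zero_on_degenerate _ _ _ _ _ D S) => i.
rewrite -!compA (compA iota) iotaE.
exact: alternating_face_sum_degen.
Qed.
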